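(* Suppose $K$ and $K_\delta$ are even and let $\rho_0\ge0$ be compactly supported. Let $\tilde X_i(t)$, $t\in[0,T_0]$, be the approximate particle trajectories of the blob method, let $$\hat\rho(x,t)=\sum_{j\in\mathbb Z^d}\delta_{0}(x-\tilde X_j(t))\,\rho_{0j}h^d$$ be the corresponding particle system (a finite sum of Dirac masses; $\delta_0$ is the Dirac mass at the origin), and let $E_\delta$ be the regularized interaction energy, so that $$E_\delta(\hat\rho(t))=\frac12\sum_{i,j}K_\delta(\tilde X_i(t)-\tilde X_j(t))\,\rho_{0i}\rho_{0j}h^dh^d.$$ Then the regularized energy decreases along the particle system: $\frac{d}{dt}E_\delta(\hat\rho(t))\le0$ for $t\in[0,T_0]$.
   Context: $d\ge1$, $K:\mathbb R^d\to\mathbb R$ is a kernel, $\psi$ is a smooth, radial, rapidly decreasing mollifier, $\delta>0$, $\psi_\delta(x)=\delta^{-d}\psi(x/\delta)$, $K_\delta=K*\psi_\delta$. It is a standing fact in the setting that $K_\delta$ is differentiable with $\nabla K_\delta$ and $\Delta K_\delta$ locally Lipschitz. For $h>0$, $h\mathbb Z^d$ is the grid of spacing $h$ and $\rho_{0j}=\rho_0(jh)$. The approximate particle trajectories of the blob method solve $$\frac{d}{dt}\tilde X_i(t)=-\sum_j\nabla K_\delta(\tilde X_i(t)-\tilde X_j(t))\rho_{0j}h^d,\qquad \tilde X_i(0)=ih,\quad i\in\mathbb Z^d,$$ and $[0,T_0]$ is a time interval on which this solution exists. The regularized energy is $E_\delta(\rho)=\frac12\int_{\mathbb R^d\times\mathbb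 R^d}\rho(x)K_\delta(x-y)\rho(y)\,dx\,dy$ (for measures, interpreted as integration against $\rho\otimes\rho$). *)

(* Defs.v *)
From HB Require Import structures.
From mathcomp Require Import all_boot all_order all_algebra finmap.
From mathcomp Require Import all_classical all_reals all_analysis.

Set Implicit Arguments.
Unset Strict Implicit.
Unset Printing Implicit Defensive.
Import Order.TTheory GRing.Theory Num.Theory.
Import numFieldNormedType.Exports.

Local Open Scope classical_set_scope.
Local Open Scope ring_scope.

(* The space R^d is 'rV[R]_d.  Its library norm is the sup norm; it induces
   the usual topology, and hence the usual notions of limit, derivative,
   compactness and Lipschitz continuity. *)

Definition rV_display : measure_display.
Proof. exact: default_measure_display. Qed.

(* The sigma-algebra on R^n generated by the coordinate maps, that is, the
   Borel sigma-algebra. *)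
Section measurable_rV.
Context (R : realType) (n : nat).

Let coor (i : 'I_n) (x : 'rV[R]_n) : measurableTypeR R := x ord0 i.

Let rV_set0 : g_sigma_preimage coor set0.
Proof. exact: sigma_algebra0. Qed.

Let rV_setC A : g_sigma_preimage coor A -> g_sigma_preimage coor (~` A).
Proof. exact: sigma_algebraC. Qed.

Let rV_bigcup (F : _^nat) : (forall i, g_sigma_preimage coor (F i)) ->
  g_sigma_preimage coor (\bigcup_i (F i)).
Proof. exact: sigma_algebra_bigcup. Qed.

HB.instance Definition _ := @isMeasurable.Build rV_display
  'rV[R]_n (g_sigma_preimage coor) rV_set0 rV_setC rV_bigcup.

End measurable_rV.

Section measurable_rV_lemmas.
Context (R : realType).

Lemma measurable_coord n (i : 'I_n) :
  measurable_fun [set: 'rV[R]_n] (fun x : 'rV[R]_n => x ord0 i).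
Proof.
move=> _ Y mY; rewrite setTI; apply: sub_sigma_algebra => /=.
rewrite -bigcup_seq/=; exists i => /=; first by rewrite mem_index_enum.
by exists Y => //; rewrite setTI.
Qed.

Lemma measurable_fun_rVP d (T : measurableType d) n (f : T -> 'rV[R]_n) :
  measurable_fun [set: T] f <->
  forall i, measurable_fun [set: T] (fun t => f t ord0 i).
Proof.
split=> [mf i|mf].
  exact: (measurableT_comp (@measurable_coord n i) mf).
have sub : (@measurable _ 'rV[R]_n) `<=`
    [set A | measurable (f @^-1` A)].
  apply: smallest_sub.
    split => [|A mA|F mF] /=.
    - by rewrite preimage_set0.
    - by rewrite setTD preimage_setC; exact: measurableC.
    - by rewrite preimage_bigcup; exact: bigcupT_measurable.
  rewrite -bigcup_seq; apply: bigcup_sub => i _ A [B mB <-] /=.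
  rewrite setTI -comp_preimage -[X in measurable X]setTI.
  exact: (mf i).
by move=> _ A mA; rewrite setTI; exact: sub.
Qed.

Definition cons_rV n (p : measurableTypeR R * 'rV[R]_n) : 'rV[R]_n.+1 :=
  row_mx (p.1 : R)%:M p.2.

Lemma cons_rV0 n p : @cons_rV n p ord0 ord0 = p.1.
Proof.
transitivity ((p.1 : R)%:M (ord0 : 'I_1) (ord0 : 'I_1)); last by rewrite mxE mulr1n.
rewrite -(row_mxEl (p.1 : R)%:M p.2 ord0 (ord0 : 'I_1)).
by rewrite /cons_rV; congr (row_mx _ _ _ _); exact: val_inj.
Qed.

Lemma cons_rVS n p (i : 'I_n) : cons_rV p ord0 (lift ord0 i) = p.2 ord0 i.
Proof.
rewrite -(row_mxEr (p.1 : R)%:M p.2 ord0 i).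
by rewrite /cons_rV; congr (row_mx _ _ _ _); exact: val_inj.
Qed.

Lemma measurable_cons_rV n : measurable_fun setT (@cons_rV n).
Proof.
apply/measurable_fun_rVP => i; case: (unliftP ord0 i) => [j|] ->.
  under eq_fun do rewrite cons_rVS.
  exact: (measurableT_comp (@measurable_coord n j) measurable_snd).
under eq_fun do rewrite cons_rV0.
exact: measurable_fst.
Qed.

End measurable_rV_lemmas.

(* The product of Lebesgue measure on R with m, transported to R^(n+1). *)
Section lebesgue_cons.
Context (R : realType) (n : nat).
Variable m : {sigma_finite_measure set 'rV[R]_n -> \bar R}.

Definition lebesgue_cons : set 'rV[R]_n.+1 -> \bar R :=
  pushforward (@lebesgue_measure R \x m)%E (@cons_rV R n).

Let lebesgue_cons0 : lebesgue_cons set0 = 0%E.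
Proof. by rewrite /lebesgue_cons /pushforward preimage_set0 measure0. Qed.

Let lebesgue_cons_ge0 A : (0 <= lebesgue_cons A)%E.
Proof. by rewrite /lebesgue_cons /pushforward; exact: measure_ge0. Qed.

Let lebesgue_cons_sigma_additive : semi_sigma_additive lebesgue_cons.
Proof.
move=> F mF tF mUF; rewrite /lebesgue_cons /pushforward preimage_bigcup.
have mc B : measurable B -> measurable (@cons_rV R n @^-1` B).
  by move=> mB; rewrite -[X in measurable X]setTI; exact: measurable_cons_rV.
apply: measure_semi_sigma_additive.
- by move=> k; exact: mc.
- apply/trivIsetP => /= i j _ _ ij; rewrite -preimage_setI.
  by move/trivIsetP : tF => /(_ _ _ _ _ ij) ->//; rewrite preimage_set0.
- by rewrite -preimage_bigcup; exact: mc.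
Qed.

HB.instance Definition _ := isMeasure.Build _ _ _ lebesgue_cons
  lebesgue_cons0 lebesgue_cons_ge0 lebesgue_cons_sigma_additive.

Let lebesgue_cons_sigma_finite : sigma_finite setT lebesgue_cons.
Proof.
have /sigma_finiteP[F [TF ndF Foo]] := sigma_finiteT (@lebesgue_measure R).
have /sigma_finiteP[G [TG ndG Goo]] := sigma_finiteT m.
pose uncons (v : 'rV[R]_n.+1) : measurableTypeR R * 'rV[R]_n :=
  (v ord0 ord0, \row_i v ord0 (lift ord0 i)).
have munc : measurable_fun setT uncons.
  apply/measurable_fun_pairP; split; first exact: measurable_coord.
  apply/measurable_fun_rVP => i /=.
  under eq_fun do rewrite mxE.
  exact: measurable_coord.
have consK p : uncons (cons_rV p) = p.
  rewrite /uncons cons_rV0; case: p => x v /=; congr pair.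
  by apply/rowP => i; rewrite mxE cons_rVS.
exists (fun k => uncons @^-1` (F k `*` G k)).
  rewrite -preimage_bigcup; apply/esym; rewrite -subTset => v _ /=.
  have [k1 _ Fk] : (\bigcup_k F k) (uncons v).1 by rewrite -TF.
  have [k2 _ Gk] : (\bigcup_k G k) (uncons v).2 by rewrite -TG.
  exists (maxn k1 k2) => //; split.
  - by move: Fk; exact/subsetPset/ndF/leq_maxl.
  - by move: Gk; exact/subsetPset/ndG/leq_maxr.
move=> k; have [mF Fk] := Foo k; have [mG Gk] := Goo k; split.
  by rewrite -[X in measurable X]setTI; apply: munc => //; exact: measurableX.
rewrite /lebesgue_cons /pushforward -comp_preimage.
rewrite (_ : uncons \o _ = id); last by apply/funext => p; exact: consK.
by rewrite preimage_id product_measure1E// lte_mul_pinfty// ge0_fin_numE.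
Qed.

HB.instance Definition _ := Measure_isSigmaFinite.Build _ _ _ lebesgue_cons
  lebesgue_cons_sigma_finite.

End lebesgue_cons.

Fixpoint lebesgue_rV (R : realType) (n : nat) :
    {sigma_finite_measure set 'rV[R]_n -> \bar R} :=
  if n is m.+1 then @lebesgue_cons R m (lebesgue_rV R m)
  else @dirac _ 'rV[R]_0 0 R.

Section calculus.
Context (R : realType) (d : nat).
Implicit Types (f : 'rV[R]_d -> R) (x : 'rV[R]_d).

Definition partial f (i : 'I_d) x : R := 'D_(delta_mx ord0 i) f x.

Definition gradient f x : 'rV[R]_d := \row_i partial f i x.

Definition laplacian f x : R := \sum_i partial (partial f i) i x.

Definition iter_partial f (s : seq 'I_d) : 'rV[R]_d -> R :=
  foldr (fun i g => partial g i) f s.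

(* C^infinity: in particular every iterated partial derivative exists and is
   continuous. *)
Definition smooth f :=
  forall (s : seq 'I_d) x, differentiable (iter_partial f s) x.

Definition euclidean_norm x : R := Num.sqrt (\sum_i x ord0 i ^+ 2).

Definition radial f := exists g : R -> R, forall x, f x = g (euclidean_norm x).

(* Together with smoothness: f is a Schwartz function. *)
Definition rapidly_decreasing f :=
  forall (s : seq 'I_d) (k : nat), exists C : R,
    forall x, `|x| ^+ k * `|iter_partial f s x| <= C.

Definition even_function f := forall x, f (- x) = f x.

Definition locally_lipschitz (V : normedModType R) (F : 'rV[R]_d -> V) :=
  forall x, exists2 U, nbhs x U & [lipschitz F y | y in U].

(* Derivative at t of f : A -> V, one-sided when t is an endpoint of the
   interval A. *)
Definition is_derive_within (V : normedModType R) (A : set R) (f : R -> V)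
    (t : R) (l : V) :=
  (s - t)^-1 *: (f s - f t) @[s --> within A t^'] --> l.

End calculus.

Section blob_method.
Context (R : realType) (d : nat).
Implicit Types (K psi Kd : 'rV[R]_d -> R).
Implicit Types (mu : {finite_measure set 'rV[R]_d -> \bar R}).

(* No sign is imposed on psi. *)
Definition mollifier psi :=
  [/\ smooth psi, radial psi, rapidly_decreasing psi &
      (\int[lebesgue_rV R d]_x (psi x)%:E = 1)%E].

Definition rescale (delta : R) psi : 'rV[R]_d -> R :=
  fun x => delta ^- d * psi (delta^-1 *: x).

Definition convolution f g : 'rV[R]_d -> R :=
  fun x => \int[lebesgue_rV R d]_y (f (x - y) * g y).

(* K_delta = K * psi_delta *)
Definition regularized_kernel K psi delta :=
  convolution K (rescale delta psi).

Definition regular_kernel Kd :=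
  [/\ forall x, differentiable Kd x,
      forall i x, derivable (partial Kd i) x (delta_mx ord0 i),
      locally_lipschitz (gradient Kd) &
      locally_lipschitz (laplacian Kd)].

(* The point j h of the grid h Z^d. *)
Definition grid_point (h : R) (j : 'rV[int]_d) : 'rV[R]_d :=
  h *: map_mx intr j.

Definition compactly_supported (rho0 : 'rV[R]_d -> {nonneg R}) :=
  compact (closure [set x | (rho0 x)%:num != 0]).

(* rho_{0j} h^d *)
Definition mass (rho0 : 'rV[R]_d -> {nonneg R}) (h : {posnum R})
    (j : 'rV[int]_d) : {nonneg R} :=
  ((rho0 (grid_point h%:num j))%:num * h%:num ^+ d)%:nng.

(* The sum ranges over all of Z^d; it is a finite sum, since all but finitely
   many masses vanish when rho0 is compactly supported. *)
Definition blob_trajectories Kd (rho0 : 'rV[R]_d -> {nonneg R})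
    (h : {posnum R}) (T0 : R) (X : 'rV[int]_d -> R -> 'rV[R]_d) :=
  forall i : 'rV[int]_d, X i 0 = grid_point h%:num i /\
    forall t, t \in `[0, T0] ->
      is_derive_within [set` `[0, T0]] (X i) t
        (- \sum_(j \in [set: 'rV[int]_d])
             (mass rho0 h j)%:num *: gradient Kd (X i t - X j t)).

(* E_delta(mu), with Kd = K_delta *)
Definition energy Kd mu : R :=
  2^-1 * \int[(mu \x mu)%E]_z Kd (z.1 - z.2).

End blob_method.

(* The sum of the Dirac masses w_j at x_j over the j such that w_j is nonzero,
   which are assumed to be finitely many (fset_set of an infinite set is
   empty). *)
Section particle_measure.
Context d (T : measurableType d) (R : realType) (I : choiceType).
Variables (w : I -> {nonneg R}) (x : I -> T).

Definition particle_measure (A : set T) : \bar R :=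
  (\sum_(j <- fset_set [set j | (w j)%:num != 0%R])
     (w j)%:num%:E * \d_(x j) A)%E.

Let particle_measure0 : particle_measure set0 = 0%E.
Proof. by rewrite /particle_measure big1// => j _; rewrite measure0 mule0. Qed.

Let particle_measure_ge0 A : (0 <= particle_measure A)%E.
Proof. by apply: sume_ge0 => j _; rewrite mule_ge0. Qed.

Let particle_measure_sigma_additive : semi_sigma_additive particle_measure.
Proof.
case E : (enum_fset (fset_set [set j | (w j)%:num != 0%R])) => [|j0 s].
  move=> F mF tF mUF; rewrite /particle_measure E big_nil.
  rewrite (_ : (fun n => _) = cst 0%E); first exact: cvg_cst.
  by apply/funext => n; rewrite big1// => i _; rewrite big_nil.
rewrite (_ : particle_measure = msum (fun k =>
    mscale (w (nth j0 (j0 :: s) k)) (dirac (x (nth j0 (j0 :: s) k))))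
    (size (j0 :: s))); first exact: measure_semi_sigma_additive.
by apply/funext => A; rewrite /particle_measure E (big_nth j0) big_mkord.
Qed.

HB.instance Definition _ := isMeasure.Build _ _ _ particle_measure
  particle_measure0 particle_measure_ge0 particle_measure_sigma_additive.

Let particle_measure_fin : fin_num_fun particle_measure.
Proof.
move=> A mA; rewrite /particle_measure sum_fin_num.
by apply/allP => _ /mapP[j _ ->] /=; rewrite fin_numM// diracE; case: (_ \in _).
Qed.

HB.instance Definition _ :=
  Measure_isFinite.Build _ _ _ particle_measure particle_measure_fin.

End particle_measure.

Definition particle_system (R : realType) (d : nat)
    (rho0 : 'rV[R]_d -> {nonneg R}) (h : {posnum R})
    (X : 'rV[int]_d -> R -> 'rV[R]_d) (t : R) :
    {finite_measure set 'rV[R]_d -> \bar R} :=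
  particle_measure (mass rho0 h) (fun j => X j t).

(* Main.v *)
Require Import Defs.
From mathcomp Require Import all_boot all_order all_algebra.
From mathcomp Require Import all_classical all_reals all_analysis.
From mathcomp Require Import measurable_realfun.
Import Order.TTheory GRing.Theory Num.Theory.
Import numFieldNormedType.Exports.

(** The blob method is the gradient flow of the discrete energy for the inner
    product weighted by the masses: the velocity of particle [i] is
    [V_i = - sum_j m_j g_ij] with [g_ij = grad K_delta (X_i - X_j)], and the
    chain rule gives
    [dE/dt = 1/2 sum_ij m_i m_j <g_ij, V_i - V_j>].  As [K_delta] is even its
    gradient is odd ([gradient_even]), so [g_ji = - g_ij]; exchanging [i] and
    [j] in the terms with [V_j] doubles the terms with [V_i], and
    [dE/dt = - sum_i m_i |V_i|^2 <= 0] ([interaction_power]).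

    Two points need care.  The energy is an integral against the tensor
    square of the particle measure, and it equals the double sum because
    [K_delta], being continuous, is measurable for the sigma-algebra generated
    by the coordinates ([continuous_measurable_rV]), so that Tonelli's theorem
    applies to its positive and negative parts
    ([Rintegral_particle_measure2]).  And time derivatives are relative to
    [[0, T0]], hence one-sided at its endpoints, so the chain rule is proved
    for difference quotients along a punctured neighbourhood within a set
    ([is_derive_within_comp]).  All sums over the grid are finite since a
    bounded set contains finitely many grid points ([finite_mass]). *)

Local Open Scope classical_set_scope.
Local Open Scope ring_scope.

(** * Borel sets of the space of row vectors *)

(** An open set is the union of the countably many balls of rational centre
    and radius [1 / (m + 1)] that it contains; a ball for the sup norm is a
    finite intersection of preimages of intervals under the coordinates. *)
Lemma open_measurable_rV (R : realType) n (U : set 'rV[R]_n) :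
  open U -> measurable U.
Proof.
move=> oU.
pose B (k : 'rV[rat]_n * nat) : set 'rV[R]_n :=
  ball (map_mx ratr k.1 : 'rV[R]_n) (k.2.+1%:R^-1).
have -> : U = \bigcup_(k in [set k | B k `<=` U]) B k.
  apply/seteqP; split=> [x Ux|x [k /= kU]]; last exact: kU.
  have /nbhs_ballP[e /= e0 eU] := open_nbhs_nbhs (conj oU Ux).
  have [m /= me] : exists m, m.+1%:R^-1 < e / 2.
    have [m _ /(_ m (leqnn m)) me] :=
      near_infty_natSinv_lt (PosNum (divr_gt0 e0 (ltr0n _ 2))).
    by exists m.
  have /choice[q Hq] i : exists q : rat, ball (x ord0 i) (m.+1%:R^-1) (ratr q).
    have [] := @dense_rat R (ball (x ord0 i) m.+1%:R^-1).
    - by exists (x ord0 i); exact: ballxx.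
    - exact: ball_open.
    - by move=> y [By [q _ qy]]; exists q; rewrite qy.
  exists ((\row_i q i : 'rV[rat]_n), m) => /=.
    move=> y; rewrite /B /= => By; apply: eU.
    apply: (@le_ball _ _ _ (m.+1%:R^-1 + m.+1%:R^-1)).
      by rewrite [e]splitr lerD// ltW.
    by apply: ball_triangle By; split=> // i j; rewrite !mxE ord1; exact: Hq.
  by split=> // i j; rewrite !mxE ord1; apply: ball_sym; exact: Hq.
rewrite bigcup_mkcond; apply: countable_bigcupT_measurable => // k.
case: ifPn => _ //.
have -> : B k = \bigcap_(i in [set: 'I_n]) ((fun x : 'rV[R]_n => x ord0 i) @^-1`
    ball ((map_mx ratr k.1 : 'rV[R]_n) ord0 i) (k.2.+1%:R^-1)).
  apply/seteqP; split=> x Bx; first by move=> i _ /=; exact: (Bx.2 ord0 i).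
  by split=> // i j; rewrite ord1; exact: Bx.
apply: fin_bigcap_measurable => // i _.
rewrite -[X in measurable X]setTI; apply: measurable_coord => //.
by apply: open_measurable; exact: ball_open.
Qed.

Lemma continuous_measurable_rV (R : realType) n (f : 'rV[R]_n -> R) :
  continuous f -> measurable_fun setT f.
Proof.
move=> /continuousP cf; apply: (measurability _ (RGenOpens.measurableE R)).
move=> _ [_ [a [b ->] <-]]; rewrite setTI.
by apply: open_measurable_rV; apply: cf; exact: interval_open.
Qed.

(** * Integration against finite sums of Dirac masses *)

Section particle_integral.
Context d (T : measurableType d) (R : realType) (I : choiceType).
Context (w : I -> {nonneg R}) (x : I -> T).
Let S : seq I := finmap.enum_fset (fset_set [set j | (w j)%:num != 0%R]).

Lemma ge0_integral_particle_measure (f : T -> \bar R) :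
  measurable_fun setT f -> (forall y, (0 <= f y)%E) ->
  (\int[particle_measure w x]_y f y = \sum_(j <- S) (w j)%:num%:E * f (x j))%E.
Proof.
move=> mf f0.
case E : S => [|j0 s].
  rewrite big_nil (@eq_measure_integral _ _ _ _ mzero) ?integral_measure_zero//.
  by move=> A _ _ /=; rewrite /particle_measure -/S E big_nil.
rewrite (@eq_measure_integral _ _ _ _ (msum (fun k =>
    mscale (w (nth j0 (j0 :: s) k)) (dirac (x (nth j0 (j0 :: s) k))))
    (size (j0 :: s)))); last first.
  by move=> A _ _; rewrite /= /particle_measure -/S E (big_nth j0) big_mkord.
rewrite ge0_integral_measure_sum// (big_nth j0) big_mkord.
apply: eq_bigr => k _; rewrite ge0_integral_mscale//.
by rewrite integral_dirac// diracT mul1e.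
Qed.

(** [f] may change sign, so Tonelli's theorem is applied to its positive and
    negative parts; both iterated sums are finite, hence may be subtracted. *)
Lemma Rintegral_particle_measure2 (f : T * T -> R) :
  measurable_fun setT f ->
  \int[(particle_measure w x \x particle_measure w x)%E]_z f z =
  \sum_(i <- S) \sum_(j <- S) (w i)%:num * (w j)%:num * f (x i, x j).
Proof.
move=> mf.
have tonelli (g : T * T -> R) : measurable_fun setT g -> (forall z, 0 <= g z) ->
    (\int[particle_measure w x \x particle_measure w x]_z (g z)%:E =
    (\sum_(i <- S) \sum_(j <- S) (w i)%:num * (w j)%:num * g (x i, x j))%:E)%E.
  move=> mg g0.
  have mG : measurable_fun setT (EFin \o g) by exact/measurable_EFinP.
  rewrite fubini_tonelli1//.
  rewrite ge0_integral_particle_measure.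
  - rewrite -sumEFin; apply: eq_bigr => i _; rewrite /fubini_F.
    rewrite ge0_integral_particle_measure; last 2 first.
    + exact: (measurableT_comp mG (pair1_measurable (x i))).
    + by move=> y; rewrite lee_fin.
    rewrite ge0_sume_distrr; last by move=> j _; rewrite mule_ge0// lee_fin.
    by rewrite -sumEFin; apply: eq_bigr => j _; rewrite /= -!EFinM mulrA.
  - by apply: measurable_fun_fubini_tonelli_F => // z; rewrite lee_fin.
  - by move=> y; apply: integral_ge0 => z _; rewrite lee_fin.
rewrite /Rintegral integralE funerpos funerneg.
rewrite (tonelli _ (measurable_funrpos mf) (funrpos_ge0 f)).
rewrite (tonelli _ (measurable_funrneg mf) (funrneg_ge0 f)).
rewrite -EFinB /= -sumrB; apply: eq_bigr => i _; rewrite -sumrB.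
by apply: eq_bigr => j _; rewrite -mulrBr -[in RHS](funrposBneg f).
Qed.

End particle_integral.

(** * The particles that carry mass *)

Lemma finite_intmx_bounded n (N : nat) :
  finite_set [set j : 'rV[int]_n | forall i, `|j ord0 i| <= N%:Z].
Proof.
(* The box is the image of a finite type under translation by [- N]. *)
pose f (v : 'rV['I_(N + N).+1]_n) : 'rV[int]_n :=
  map_mx (fun k : 'I_(N + N).+1 => (k : nat)%:Z - N%:Z) v.
apply: (@sub_finite_set _ _ (f @` setT)); last first.
  by apply: finite_image; exact: finite_finset.
move=> j jN; exists (map_mx (fun z : int => inord (absz (z + N%:Z))) j) => //.
apply/rowP => i; rewrite !mxE; have := jN i => jNi.
move: (j ord0 i) jNi => z; rewrite ler_norml => /andP[Nz zN].
have zN0 : 0 <= z + N%:Z by rewrite -lerBlDr sub0r.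
rewrite inordK; first by rewrite gez0_abs// addrK.
by rewrite ltnS -lez_nat gez0_abs// PoszD lerD2r.
Qed.

Lemma ler_rV_coord (R : realDomainType) n (x : 'rV[R]_n) i :
  `|x ord0 i| <= `|x|.
Proof.
by rewrite [leRHS]mx_normrE (le_trans _ (le_bigmax _ _ (ord0, i))).
Qed.

Section particles.
Context (R : realType) (d : nat).
Context (rho0 : 'rV[R]_d -> {nonneg R}) (h : {posnum R}).

Definition mass_support : seq 'rV[int]_d :=
  finmap.enum_fset (fset_set [set j | (mass rho0 h j)%:num != 0]).

Lemma finite_mass : compactly_supported rho0 ->
  finite_set [set j | (mass rho0 h j)%:num != 0].
Proof.
move=> /compact_bounded[M [_ MB]].
have {}MB x : (rho0 x)%:num != 0 -> `|x| <= `|M| + 1.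
  move=> rx; apply: (MB (`|M| + 1)) => /=; last exact: subset_closure.
  by rewrite (le_lt_trans (ler_norm _))// ltrDl.
pose N := (Num.truncn ((`|M| + 1) / h%:num)).+1.
apply: sub_finite_set (@finite_intmx_bounded d N) => j /= mj i.
have {}mj : (rho0 (grid_point h%:num j))%:num != 0.
  by apply: contra_neq mj => /= ->; rewrite mul0r.
have := le_trans (ler_rV_coord _ _ _ i) (MB _ mj).
rewrite !mxE normrM gtr0_norm// mulrC -ler_pdivlMr// => jM.
by rewrite -(ler_int R) intr_norm (le_trans jM)// ltW// truncnS_gt.
Qed.

Lemma fsbig_mass (V : nmodType) (F : 'rV[int]_d -> V) :
  compactly_supported rho0 ->
  (forall j, (mass rho0 h j)%:num = 0 -> F j = 0) ->
  \sum_(j \in [set: 'rV[int]_d]) F j = \sum_(j <- mass_support) F j.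
Proof.
move=> rho0_supp F0; rewrite -(fsbig_finite _ _ (finite_mass rho0_supp)).
apply/esym/fsbig_widen => //.
by move=> j [_ /= /negP/negPn/eqP]; exact: F0.
Qed.

Lemma energy_particle_system (Kd : 'rV[R]_d -> R)
    (X : 'rV[int]_d -> R -> 'rV[R]_d) (t : R) : continuous Kd ->
  energy Kd (particle_system rho0 h X t) = 2^-1 *
    \sum_(i <- mass_support) \sum_(j <- mass_support)
      (mass rho0 h i)%:num * (mass rho0 h j)%:num * Kd (X i t - X j t).
Proof.
move=> cK; rewrite /energy /particle_system Rintegral_particle_measure2//.
have mK : measurable_fun setT Kd by exact: continuous_measurable_rV.
apply: (@measurableT_comp _ _ _ _ _ _ Kd _
  (fun z : 'rV[R]_d * 'rV[R]_d => z.1 - z.2)) => //.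
apply/measurable_fun_rVP => i.
rewrite (_ : (fun _ => _) = (fun z : 'rV[R]_d * 'rV[R]_d => z.1 ord0 i) \-
  (fun z : 'rV[R]_d * 'rV[R]_d => z.2 ord0 i)).
  by apply: measurable_funB; apply: measurableT_comp (measurable_coord i) _.
by apply/funext=> z; rewrite !mxE.
Qed.

End particles.

Arguments mass_support {R d} rho0 h.
Arguments fsbig_mass {R d rho0} h {V F} _ _.

(** * Calculus of derivatives relative to a set *)

Section derive_within.
Context (R : realType).
Implicit Types V W : normedModType R.

(** With [D s] the difference quotient of [x] and [o] the remainder in the
    first-order expansion of [f] at [x t], the difference quotient of [f \o x]
    is ['d f (D s)], which tends to ['d f l], plus [(s - t)^-1 *: o (x s - x t)].
    As [D] stays bounded near [t], the norm of the latter is at most an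
    arbitrarily small multiple of [`|D s|], hence tends to [0]. *)
Lemma is_derive_within_comp V W (A : set R) (x : R -> V) (f : V -> W) t l :
  differentiable f (x t) -> is_derive_within A x t l ->
  is_derive_within A (f \o x) t ('d f (x t) l).
Proof.
rewrite /is_derive_within => df xl.
set F := within A t^'.
have FF : Filter F by exact: within_filter.
pose D s := (s - t)^-1 *: (x s - x t).
have Ft' : F --> t^' by exact: cvg_within.
have Ft : F --> t by apply: cvg_trans Ft' _; exact: cvg_within.
have s_neq : \forall s \near F, s != t.
  exact: (Ft' _ (nbhs_dnbhs_neq t)).
have st0 : s - t @[s --> F] --> 0.
  by rewrite -(subrr t); apply: cvgB; last exact: cvg_cst.
have dx0 : x s - x t @[s --> F] --> 0.
  rewrite -(scale0r l).
  apply: cvg_trans (cvgZ st0 xl); apply: near_eq_cvg.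
  near=> s; rewrite scalerA divff ?scale1r// subr_eq0.
  by near: s; exact: s_neq.
have [_ dfo] := (diff_locallyP _ _).1 df.
set o := 'o_ _ _ in dfo.
have -> : 'd f (x t) l = 'd f (x t) l + 0 by rewrite addr0.
rewrite (_ : (fun s => _) = fun s =>
  'd f (x t) (D s) + (s - t)^-1 *: o (x s - x t)); last first.
  apply/funext => s; rewrite linearZ -scalerDr; congr (_ *: _).
  have := congr1 (fun g => g (x s - x t)) dfo.
  rewrite /= subrK => ->.
  rewrite [X in X - _](_ : _ = f (x t) +
    ('d f (x t) (x s - x t) + o (x s - x t))); last by rewrite addrA.
  by rewrite addrAC subrr add0r.
apply: cvgD.
  have cd : {for l, continuous ('d f (x t))} by exact: diff_continuous.
  exact: (cvg_comp _ _ xl cd).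
apply/cvgr0Pnorm_le => e e0.
have lp : 0 < `|l| + 1 by rewrite ltr_wpDl.
have oP : \forall v \near 0, `|o v| <= e / (`|l| + 1) * `|v|.
  by apply: littleoP; rewrite divr_gt0.
have Dl : \forall s \near F, `|D s| <= `|l| + 1.
  have /cvgr_norm_le/(_ (`|l|+1)) := xl.
  by apply; rewrite ltrDl.
have oF : \forall s \near F, `|o (x s - x t)| <= e / (`|l| + 1) * `|x s - x t|.
  exact: (dx0 _ oP).
near=> s.
have os : `|o (x s - x t)| <= e / (`|l| + 1) * `|x s - x t| by near: s.
rewrite normrZ (le_trans (ler_wpM2l _ os))// mulrCA -normrZ.
rewrite mulrAC ler_pdivrMr// ler_wpM2l ?(ltW e0)//.
by near: s; exact: Dl.
Unshelve. all: by end_near. Qed.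

Lemma is_derive_withinB V (A : set R) (x y : R -> V) t l m :
  is_derive_within A x t l -> is_derive_within A y t m ->
  is_derive_within A (fun s => x s - y s) t (l - m).
Proof.
move=> xl ym; rewrite /is_derive_within.
rewrite (_ : (fun s => _) = (fun s => (s - t)^-1 *: (x s - x t) -
    (s - t)^-1 *: (y s - y t))); first exact: cvgB.
apply/funext => s; rewrite -scalerBr; congr (_ *: _).
by rewrite opprD addrACA -opprD.
Qed.

Lemma is_derive_withinZ V (A : set R) (c : R) (x : R -> V) t l :
  is_derive_within A x t l -> is_derive_within A (fun s => c *: x s) t (c *: l).
Proof.
move=> xl; rewrite /is_derive_within.
rewrite (_ : (fun s => _) = (fun s => c *: ((s - t)^-1 *: (x s - x t)))).
  exact: cvgZl_tmp.
by apply/funext => s; rewrite -scalerBr !scalerA mulrC.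
Qed.

Lemma is_derive_within_sum V (A : set R) (I : Type) (r : seq I)
    (x : I -> R -> V) t (l : I -> V) :
  (forall i, is_derive_within A (x i) t (l i)) ->
  is_derive_within A (fun s => \sum_(i <- r) x i s) t (\sum_(i <- r) l i).
Proof.
move=> xl; rewrite /is_derive_within.
rewrite (_ : (fun s => _) =
  (fun s => \sum_(i <- r) ((s - t)^-1 *: (x i s - x i t)))).
  by apply: (@cvg_big _ _ _ _ _ add_continuous) => i _; exact: xl.
by apply/funext => s; rewrite -sumrB scaler_sumr.
Qed.

End derive_within.

(** * Dissipation of the interaction energy *)

Definition dot {R : comNzRingType} {n} (u v : 'rV[R]_n) : R :=
  \sum_k u ord0 k * v ord0 k.

Lemma dotDr (R : comNzRingType) n (u v w : 'rV[R]_n) :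
  dot u (v + w) = dot u v + dot u w.
Proof. by rewrite -big_split; apply: eq_bigr => k _; rewrite mxE mulrDr. Qed.

Lemma dotNr (R : comNzRingType) n (u v : 'rV[R]_n) : dot u (- v) = - dot u v.
Proof. by rewrite -sumrN; apply: eq_bigr => k _; rewrite mxE mulrN. Qed.

Lemma dotC (R : comNzRingType) n (u v : 'rV[R]_n) : dot u v = dot v u.
Proof. by apply: eq_bigr => k _; rewrite mulrC. Qed.

Lemma dot_sumr (R : comNzRingType) n (I : Type) (r : seq I) (w : I -> R)
    (u : 'rV[R]_n) (v : I -> 'rV[R]_n) :
  dot u (\sum_(i <- r) w i *: v i) = \sum_(i <- r) w i * dot u (v i).
Proof.
rewrite /dot; under [in RHS]eq_bigr do rewrite mulr_sumr.
rewrite exchange_big; apply: eq_bigr => k _ /=.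
rewrite summxE mulr_sumr; apply: eq_bigr => i _.
by rewrite mxE mulrCA.
Qed.

Lemma dot_ge0 (R : realDomainType) n (u : 'rV[R]_n) : 0 <= dot u u.
Proof. by apply: sumr_ge0 => k _; rewrite -expr2 sqr_ge0. Qed.

(** The left-hand side is the sum [P] of the terms with [V i] minus the sum of
    those with [V j].  Newton's third law, [g j i = - g i j], makes the second
    sum equal to [- P] after exchanging [i] and [j], so the total is [2 P]; and
    the inner sum of [P] is the pairing of [- V i] with [w i *: V i]. *)
Lemma interaction_power (R : comNzRingType) n (I : Type) (r : seq I)
    (w : I -> R) (g : I -> I -> 'rV[R]_n) (V : I -> 'rV[R]_n) :
  (forall i j, g j i = - g i j) ->
  (forall i, V i = - \sum_(j <- r) w j *: g i j) ->
  \sum_(i <- r) \sum_(j <- r) w i * w j * dot (g i j) (V i - V j) =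
  - (2 * \sum_(i <- r) w i * dot (V i) (V i)).
Proof.
move=> gN VE.
pose P := \sum_(i <- r) \sum_(j <- r) w i * w j * dot (g i j) (V i).
have PE : P = - \sum_(i <- r) w i * dot (V i) (V i).
  rewrite -sumrN; apply: eq_bigr => i _.
  rewrite [in X in - (_ * dot _ X)]VE dotNr mulrN opprK dot_sumr mulr_sumr.
  by apply: eq_bigr => j _; rewrite dotC mulrA.
have QE : \sum_(i <- r) \sum_(j <- r) w i * w j * dot (g i j) (V j) = - P.
  rewrite exchange_big -sumrN; apply: eq_bigr => i _ /=.
  rewrite -sumrN; apply: eq_bigr => j _.
  by rewrite gN dotC dotNr dotC mulrN (mulrC (w j)).
rewrite mulr_natl mulr2n opprD -PE -[X in _ + X]opprK -QE -sumrB.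
apply: eq_bigr => i _; rewrite -sumrB; apply: eq_bigr => j _.
by rewrite dotDr dotNr mulrDr mulrN.
Qed.

Lemma diff_dot_gradient (R : realType) n (f : 'rV[R]_n -> R) x v :
  differentiable f x -> 'd f x v = dot (gradient f x) v.
Proof.
move=> df; rewrite {1}(row_sum_delta v) linear_sum; apply: eq_bigr => k _.
by rewrite linearZ /= mxE mulrC /partial deriveE.
Qed.

Lemma gradient_even (R : realType) n (f : 'rV[R]_n -> R) x :
  even_function f -> (forall y, differentiable f y) ->
  gradient f (- x) = - gradient f x.
Proof.
(* Differentiate [f = f \o (- id)] at [x]. *)
move=> fe df; apply/rowP => k; rewrite !mxE /partial !deriveE//.
have fN : f = f \o (- id) by apply/funext => y /=; rewrite fe.
have dN : is_diff x (- id : 'rV[R]_n -> 'rV[R]_n) (- id).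
  exact: is_diffN.
have dfN : is_diff ((- id : 'rV[R]_n -> 'rV[R]_n) x) f ('d f (- x)).
  exact: differentiableP.
have [_ E] := is_diff_comp dN dfN.
rewrite -fN in E.
have Ek : 'd f x (delta_mx ord0 k) = 'd f (- x) (- delta_mx ord0 k).
  exact: (congr1 (fun F : 'rV[R]_n -> R => F (delta_mx ord0 k)) E).
apply: oppr_inj; rewrite opprK.
exact: etrans (esym (linearN ('d f (- x)) _)) (esym Ek).
Qed.

Lemma is_derive_within_interaction (R : realType) (d : nat) (I : Type)
    (r : seq I) (w : I -> R) (Kd : 'rV[R]_d -> R) (A : set R)
    (x : I -> R -> 'rV[R]_d) (v : I -> 'rV[R]_d) t :
  (forall y, differentiable Kd y) ->
  (forall i, is_derive_within A (x i) t (v i)) ->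
  is_derive_within A (fun s => 2^-1 *
      \sum_(i <- r) \sum_(j <- r) w i * w j * Kd (x i s - x j s)) t
    (2^-1 * \sum_(i <- r) \sum_(j <- r)
      w i * w j * dot (gradient Kd (x i t - x j t)) (v i - v j)).
Proof.
move=> dK xv; apply: is_derive_withinZ.
apply: is_derive_within_sum => i; apply: is_derive_within_sum => j.
apply: is_derive_withinZ; rewrite -diff_dot_gradient//.
by apply: (@is_derive_within_comp _ _ _ A (fun s => x i s - x j s) Kd) => //;
  exact: is_derive_withinB.
Qed.

Theorem mainTheorem3 (R : realType) (d : nat) (d_gt0 : (0 < d)%N)
    (K psi : 'rV[R]_d -> R) (delta : R) (delta_gt0 : 0 < delta)
    (psi_mollifier : mollifier psi)
    (Kd_regular : regular_kernel (regularized_kernel K psi delta))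
    (K_even : even_function K)
    (Kd_even : even_function (regularized_kernel K psi delta))
    (rho0 : 'rV[R]_d -> {nonneg R}) (rho0_supp : compactly_supported rho0)
    (h : {posnum R}) (T0 : R) (T0_gt0 : 0 < T0)
    (X : 'rV[int]_d -> R -> 'rV[R]_d)
    (X_blob : blob_trajectories (regularized_kernel K psi delta) rho0 h T0 X) :
  let Kd := regularized_kernel K psi delta in
  let E t := energy Kd (particle_system rho0 h X t) in
  (forall t, t \in `[0, T0] ->
     E t = 2^-1 * \sum_(i \in [set: 'rV[int]_d]) \sum_(j \in [set: 'rV[int]_d])
       Kd (X i t - X j t) * (mass rho0 h i)%:num * (mass rho0 h j)%:num) /\
  (forall t, t \in `[0, T0] ->
     exists2 l : R, is_derive_within [set` `[0, T0]] E t l & l <= 0).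
Proof.
move=> Kd E.
have [dK _ _ _] : regular_kernel Kd by [].
have cK : continuous Kd by move=> x; exact: differentiable_continuous.
have EE t : E t = _ := energy_particle_system _ _ rho0 h Kd X t cK.
split=> t tT.
  rewrite EE; congr (_ * _); rewrite (fsbig_mass h rho0_supp)//; last first.
    by move=> i mi; rewrite fsbig1// => j _; rewrite mi mulr0 mul0r.
  apply: eq_bigr => i _;
    rewrite (fsbig_mass h rho0_supp)//; last by move=> j ->; rewrite mulr0.
  by apply: eq_bigr => j _; rewrite mulrC mulrA.
pose w j := (mass rho0 h j)%:num.
pose g i j := gradient Kd (X i t - X j t).
pose V i := - \sum_(j <- mass_support rho0 h) w j *: g i j.
have XV i : is_derive_within [set` `[0, T0]] (X i) t (V i).
  have [_ /(_ t tT)] := X_blob i.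
  by rewrite (fsbig_mass h rho0_supp)// => j ->; rewrite scale0r.
have gN i j : g j i = - g i j by rewrite /g -opprB gradient_even.
rewrite (funext EE).
eexists; first exact: (is_derive_within_interaction _ _ _ _ w Kd _ X V).
rewrite (interaction_power _ _ _ _ _ _ V gN)//.
rewrite mulrN oppr_le0 mulr_ge0// mulr_ge0//.
by apply: sumr_ge0 => i _; apply: mulr_ge0; [rewrite /w|exact: dot_ge0].
Qed.
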